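(* Consider the one-hop wireless network model described in the context, with $n$ source-destination pairs and i.i.d. channel powers $\gamma_{i,j}$ with c.d.f. $F$ and mean $\mu$. Suppose $F$ satisfies condition set 1 and is of NHT type or of HT type (as defined in the context). Define $$G(x)\triangleq \frac{x}{1-F\left(\beta\mu x/2\right)},$$ where $\beta$ is the SINR target. Then, with high probability (i.e., with probability tending to $1$ as $n\to\infty$), the throughput of the network is lower bounded as $$T=\Omega\left(G^{-1}(n)\right),$$ this throughput being achieved by activating the source-destination pairs with the largest direct-link powers $\gamma_{i,i}$ and keeping all other sources silent.
   Context: Network model: there are $n$ sources $S_1,\dots,S_n$ and $n$ destinations $D_1,\dots,D_n$; $S_i$ wishes to communicate with $D_i$ in a single hop. The channel power gain from $S_i$ to $D_j$ is a random variable $\gamma_{i,j}\ge 0$; all $\gamma_{i,j}$, $i,j=1,\dots,n$, are i.i.d. with p.d.f. $f$, c.d.f. $F$, and mean $\mathbb{E}\{\gamma_{i,j}\}=\mu$. In a time slot a subset $\mathbb{S}\subset\{S_1,\dots,S_n\}$ of sources is active, each transmitting with power $1$; the others are silent. The SINR at $D_i$ is $SINR_i=\frac{\gamma_{i,i}}{N_0+\sum_{S_k\in\mathbb{S},k\ne i}\gamma_{k,i}}$ if $S_i\in\mathbb{S}$ (and $0$ otherwise), where $N_0\ge 0$ is the noise variance; $D_i$ is successful if $SINR_i>\beta$ for a fixed constant $\beta>0$. The throughput $T(\mathbb{S})$ is the number of successful destinations. An event holds with high probability (w.h.p.) if its probability tends to $1$ as $n\to\infty$. $\Omega$ is the usual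 asymptotic notation as $n\to\infty$. Condition set 1: with $h(x)\triangleq f(x)/(1-F(x))$, (i) $F^{-1}(1)=\infty$ (unbounded support), and (ii) either $\lim_{x\to\infty} x h(x)=c_0>0$ for some constant $c_0$, or $\lim_{x\to\infty}\frac{d}{dx}\frac{1}{h(x)}=0$. NHT (non-heavy-tailed, super-exponential) type: a random variable $X$ with c.d.f. $F$ satisfies $\mathbb{E}\{e^{sX}\}<\infty$ for some $s>0$ (Cramér's condition). HT (heavy-tailed, sub-exponential) type: $F$ has one of the following tails: (a) regularly varying: $1-F(x)=L(x)/x^{\alpha}$ for $x>0$, with $\alpha>2$ and $L$ slowly varying; (b) log-normal type: $1-F(x)\sim c\,x^{b}e^{-\lambda(\log x)^{g}}$ as $x\to\infty$ with $g>1$, $\lambda>0$, $c>0$, $b\in\mathbb{R}$; (c) Weibull-like: $1-F(x)\sim c\,x^{b}e^{-\lambda x^{a}}$ as $x\to\infty$ with $0<a<0.5$, $\lambda>0$, $c>0$, $b\in\mathbb{R}$. *)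

(* Defs.v *)
From HB Require Import structures.
From mathcomp Require Import all_boot all_order all_algebra.
From mathcomp Require Import all_classical all_reals all_analysis.
Set Implicit Arguments. Unset Strict Implicit. Unset Printing Implicit Defensive.
Import Order.TTheory GRing.Theory Num.Theory.
Import numFieldNormedType.Exports.
Local Open Scope classical_set_scope.
Local Open Scope ring_scope.

(** Mutual independence of a finite family of real random variables:
    product rule for every family of Borel sets (taking B i = setT for the
    indices not involved covers every subfamily). *)
Definition mutually_independent d (T : measurableType d) (R : realType)
  (P : probability T R) (I : finType) (X : I -> T -> R) : Prop :=
  forall B : I -> set R, (forall i, measurable (B i)) ->
    P (\bigcap_(i in [set: I]) (X i @^-1` B i)) =
    (\prod_(i : I) P (X i @^-1` B i))%E.

Definition is_density (R : realType) (F f : R -> R) : Prop :=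
  measurable_fun [set: R] f /\ (forall t, 0 <= f t) /\
  forall x, (F x)%:E = (\int[lebesgue_measure]_(t in [set t : R | (t <= x)%R]) (f t)%:E)%E.

Definition hazard (R : realType) (F f : R -> R) (x : R) : R := f x / (1 - F x).

Definition condition_set_1 (R : realType) (F f : R -> R) : Prop :=
  (* (i) F^{-1}(1) = +oo : unbounded support *)
  (forall x, F x < 1) /\
  ((exists c0 : R, 0 < c0 /\ (x * hazard F f x) @[x --> +oo] --> c0) \/
   ((\forall x \near +oo, derivable (fun y => (hazard F f y)^-1) x 1) /\
    (derive1 (fun y => (hazard F f y)^-1) x) @[x --> +oo] --> 0)).

Definition NHT_type (R : realType) (f : R -> R) : Prop :=
  exists s : R, 0 < s /\
    (\int[lebesgue_measure]_(t in [set: R]) (expR (s * t) * f t)%:E < +oo)%E.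

Definition slowly_varying (R : realType) (L : R -> R) : Prop :=
  measurable_fun [set: R] L /\ (\forall x \near +oo, 0 < L x) /\
  forall a : R, 0 < a -> (L (a * x) / L x) @[x --> +oo] --> (1 : R).

Definition asympt_equiv (R : realType) (u v : R -> R) : Prop :=
  (u x / v x) @[x --> +oo] --> (1 : R).

(** HT type: (a) regularly varying, (b) log-normal type, (c) Weibull-like *)
Definition HT_type (R : realType) (F : R -> R) : Prop :=
  (exists (alpha : R) (L : R -> R), 2 < alpha /\ slowly_varying L /\
     forall x, 0 < x -> 1 - F x = L x / x `^ alpha)
  \/
  (exists c b lam g : R, 1 < g /\ 0 < lam /\ 0 < c /\
     asympt_equiv (fun x => 1 - F x)
       (fun x => c * x `^ b * expR (- (lam * (ln x) `^ g))))
  \/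
  (exists c b lam a : R, 0 < a /\ a < 2^-1 /\ 0 < lam /\ 0 < c /\
     asympt_equiv (fun x => 1 - F x)
       (fun x => c * x `^ b * expR (- (lam * x `^ a)))).

Definition interference (R : realType) (n : nat) (gam : 'I_n -> 'I_n -> R)
  (S : {set 'I_n}) (i : 'I_n) : R :=
  \sum_(k in S | k != i) gam k i.

(** D_i is successful: S_i active and SINR_i = gam_ii/(N0 + I_i) > beta.
    Written multiplicatively (beta * (N0 + I_i) < gam_ii) so that the case of
    a zero denominator (SINR = +oo) is treated correctly. *)
Definition successful (R : realType) (n : nat) (N0 beta : R)
  (gam : 'I_n -> 'I_n -> R) (S : {set 'I_n}) (i : 'I_n) : bool :=
  (i \in S) && (beta * (N0 + interference gam S i) < gam i i).

Definition throughput (R : realType) (n : nat) (N0 beta : R)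
  (gam : 'I_n -> 'I_n -> R) (S : {set 'I_n}) : nat :=
  #|[set i | successful N0 beta gam S i]|.

Definition is_top_k (R : realType) (n : nat) (gam : 'I_n -> 'I_n -> R)
  (k : nat) (S : {set 'I_n}) : Prop :=
  #|S| = k /\ forall i j, i \in S -> j \notin S -> gam j j <= gam i i.

Definition Gfun (R : realType) (F : R -> R) (beta mu : R) (x : R) : R :=
  x / (1 - F (beta * mu * x / 2)).

(* Main.v *)
Require Import Defs.
From HB Require Import structures.
From mathcomp Require Import all_boot all_order all_algebra.
From mathcomp Require Import all_classical all_reals all_analysis.
From mathcomp Require Import measurable_realfun.
From mathcomp Require Import ring lra.
Import Order.TTheory GRing.Theory Num.Theory.
Import numFieldNormedType.Exports.
Set Implicit Arguments. Unset Strict Implicit. Unset Printing Implicit Defensive.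
Local Open Scope ring_scope.

(** Let x = G^{-1}(n), so that n (1 - F(beta mu x / 2)) = x, and m = x / 512.
    Since F is continuous there is tau >= beta mu x / 2 with n (1 - F tau) = m;
    the set L of pairs with direct gain above tau has size about m by
    Chebyshev.  Activating the k = floor(m / 2) strongest pairs activates a
    subset of L, and an active pair can only fail if the interference it would
    receive from all of L exceeds mu x / 4.  The gains inside L x L are
    independent of L, so the total interference inside L is w.h.p. of order
    mu m^2, which is only a small fraction of m (mu x / 4): few pairs of L
    fail.  Only the mean of the gains is needed, because they are rounded up to
    multiples of mu and capped at mu x^(3/2); this rounding also turns the
    probabilistic part into moment computations for a finite product law. *)

(** * Moments under a finite product law *)

Section FiniteProduct.
Variables (R : realFieldType) (I V : finType) (pr : I -> V -> R).
Hypothesis pr_ge0 : forall p v, 0 <= pr p v.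
Hypothesis pr_sum1 : forall p, \sum_v pr p v = 1.

Definition weight (z : {ffun I -> V}) : R := \prod_p pr p (z p).

Definition Ex (phi : {ffun I -> V} -> R) : R := \sum_z weight z * phi z.

Definition mean (p : I) (h : V -> R) : R := \sum_v pr p v * h v.

(** A product of one-coordinate functions, kept as a list so that independence can be applied by
    peeling off one factor at a time. *)
Definition mono (s : seq (I * (V -> R))) (z : {ffun I -> V}) : R :=
  \prod_(x <- s) x.2 (z x.1).

Lemma weight_ge0 z : 0 <= weight z.
Proof. by apply: prodr_ge0 => p _; apply: pr_ge0. Qed.

Lemma eq_Ex phi psi : phi =1 psi -> Ex phi = Ex psi.
Proof. by move=> e; apply: eq_bigr => z _; rewrite e. Qed.

Lemma ler_Ex phi psi : (forall z, phi z <= psi z) -> Ex phi <= Ex psi.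
Proof. by move=> e; apply: ler_sum => z _; apply: ler_wpM2l; rewrite ?weight_ge0. Qed.

Lemma ExZ a phi : Ex (fun z => a * phi z) = a * Ex phi.
Proof. by rewrite /Ex mulr_sumr; apply: eq_bigr => z _; rewrite mulrCA. Qed.

Lemma ExD phi psi : Ex (fun z => phi z + psi z) = Ex phi + Ex psi.
Proof. by rewrite /Ex -big_split; apply: eq_bigr => z _; rewrite mulrDr. Qed.

Lemma Ex_sum (J : finType) (Q : pred J) (phi : J -> {ffun I -> V} -> R) :
  Ex (fun z => \sum_(j | Q j) phi j z) = \sum_(j | Q j) Ex (phi j).
Proof. by rewrite exchange_big; apply: eq_bigr => z _; rewrite mulr_sumr. Qed.

Lemma mean_cst p a : mean p (fun=> a) = a.
Proof. by rewrite /mean -mulr_suml pr_sum1 mul1r. Qed.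

Lemma eq_mean p h1 h2 : h1 =1 h2 -> mean p h1 = mean p h2.
Proof. by move=> e; apply: eq_bigr => v _; rewrite e. Qed.

(** Distributivity turns the sum over configurations into a product over coordinates; factors on the
    same coordinate stay under one [mean]. *)
Lemma Ex_mono s : Ex (mono s) =
  \prod_r mean r (fun v => \prod_(x <- s | x.1 == r) x.2 v).
Proof.
rewrite /Ex /mean bigA_distr_bigA; apply: eq_bigr => z _.
rewrite big_split; congr (_ * _).
rewrite /mono [LHS](partition_big (fun x => x.1) predT) //=.
by apply: eq_bigr => r _; apply: eq_bigr => x /eqP ->.
Qed.

Lemma Ex_mono0 : Ex (mono [::]) = 1.
Proof.
rewrite Ex_mono big1 // => r _.
by rewrite -[RHS](mean_cst r); apply: eq_mean => v; rewrite big_nil.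
Qed.

(** Independence in usable form. Only the head coordinate has to be fresh; the tail may repeat
    coordinates, as happens when two links share an endpoint. *)
Lemma Ex_mono_cons p h s : p \notin map fst s ->
  Ex (mono ((p, h) :: s)) = mean p h * Ex (mono s).
Proof.
move=> pNs; rewrite !Ex_mono (bigD1 p) //= [in RHS](bigD1 p) //=.
have s0 v : \prod_(x <- s | x.1 == p) x.2 v = 1.
  elim: s pNs => [|x s IHs] /=; first by rewrite big_nil.
  by rewrite inE negb_or big_cons eq_sym => /andP[/negPf -> /IHs].
rewrite [X in _ = _ * (X * _)](_ : _ = 1) ?mul1r; last first.
  by rewrite -[RHS](mean_cst p); apply: eq_mean.
congr (_ * _).
  by apply: eq_bigr => v _; rewrite big_cons /= eqxx s0 mulr1.
apply: eq_bigr => r rp; apply: eq_bigr => v _.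
by rewrite big_cons /= eq_sym (negPf rp).
Qed.

Lemma Ex_markov (phi : {ffun I -> V} -> R) (A : pred {ffun I -> V}) (l : R) :
  0 < l -> (forall z, 0 <= phi z) -> (forall z, A z -> l <= phi z) ->
  Ex (fun z => (A z)%:R) <= Ex phi / l.
Proof.
move=> l0 phi0 Al; rewrite mulrC -ExZ; apply: ler_Ex => z.
case: (boolP (A z)) => [/Al Az|_].
  by rewrite mulrC ler_pdivlMr // mul1r.
by rewrite mulr_ge0 // invr_ge0 ltW.
Qed.

Lemma Ex_chebyshev (phi : {ffun I -> V} -> R) (A : pred {ffun I -> V}) (l : R) :
  0 < l -> (forall z, A z -> l <= `|phi z|) ->
  Ex (fun z => (A z)%:R) <= Ex (fun z => phi z ^+ 2) / l ^+ 2.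
Proof.
move=> l0 Al; apply: Ex_markov; first by rewrite exprn_gt0.
  by move=> z; exact: sqr_ge0.
move=> z /Al Az.
by rewrite -(real_normK (num_real (phi z))) ler_pXn2r ?nnegrE ?normr_ge0 ?(ltW l0).
Qed.

(** Variance of a sum of uncorrelated terms: after expanding the square only the diagonal
    survives. *)
Lemma Ex_sqr_sum (J : finType) (Q : pred J) (U : J -> {ffun I -> V} -> R) (b : R) :
  (forall j k, Q j -> Q k -> j != k -> Ex (fun z => U j z * U k z) = 0) ->
  (forall j, Q j -> Ex (fun z => U j z ^+ 2) <= b) ->
  Ex (fun z => (\sum_(j | Q j) U j z) ^+ 2) <= #|Q|%:R * b.
Proof.
move=> U0 Ub.
rewrite (eq_Ex (psi := fun z => \sum_(j | Q j) \sum_(k | Q k) U j z * U k z)).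
  rewrite Ex_sum mulrC mulr_natr -sumr_const; apply: ler_sum => j Qj.
  rewrite Ex_sum (bigD1 j) //= big1 ?addr0; first exact: Ub.
  by move=> k /andP[Qk kj]; apply: U0; rewrite // eq_sym.
by move=> z; rewrite expr2 mulr_suml; apply: eq_bigr => j _; rewrite mulr_sumr.
Qed.

Lemma mean_centered p h : mean p (fun v => h v - mean p h) = 0.
Proof.
rewrite -[RHS](subrr (mean p h)) -[X in _ = _ - X](mean_cst p) /mean -sumrB.
by apply: eq_bigr => v _; rewrite mulrBr.
Qed.

Lemma mean_variance p h : mean p (fun v => (h v - mean p h) ^+ 2) <= mean p (fun v => h v ^+ 2).
Proof.
set a := mean p h.
have -> : mean p (fun v => h v ^+ 2) = mean p (fun v => (h v - a) ^+ 2) + a ^+ 2.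
  rewrite -[a ^+ 2](mean_cst p).
  (* In h^2 = (h - a)^2 + 2a(h - a) + a^2 the cross term has mean zero. *)
  have : mean p (fun v => 2 * a * (h v - a)) = 0.
    rewrite -[RHS](mulr0 (2 * a)) -(mean_centered p h) -/a /mean mulr_sumr.
    by apply: eq_bigr => v _; rewrite mulrCA.
  move=> /(congr1 (+%R (mean p (fun v => (h v - a) ^+ 2) + mean p (fun=> a ^+ 2)))).
  rewrite addr0 => <-; rewrite /mean -!big_split.
  by apply: eq_bigr => v _ /=; ring.
by rewrite lerDl sqr_ge0.
Qed.

Lemma ler_mean p h1 h2 : (forall v, h1 v <= h2 v) -> mean p h1 <= mean p h2.
Proof. by move=> h; apply: ler_sum => v _; apply: ler_wpM2l. Qed.

Lemma meanZ p a h : mean p (fun v => a * h v) = a * mean p h.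
Proof. by rewrite /mean mulr_sumr; apply: eq_bigr => v _; rewrite mulrCA. Qed.

End FiniteProduct.

(** * Strong pairs and their mutual interference *)

Section Network.
Variables (R : realFieldType) (n K : nat).
Local Notation link := ('I_n * 'I_n)%type.
Local Notation config := {ffun link -> 'I_K.+1}.

Definition strong (z : config) : {set 'I_n} := [set i | (0 < z (i, i))%N].

Definition pos (v : 'I_K.+1) : R := (0 < v)%N%:R.

(** The link [(j, i)] goes from source [j] to destination [i]. Membership of both ends in [strong z]
    enters as 0/1 factors, so that the terms remain products of one-coordinate functions. *)
Definition pair_sum (h : link -> 'I_K.+1 -> R) (z : config) : R :=
  \sum_(p : link | p.1 != p.2) pos (z (p.1, p.1)) * pos (z (p.2, p.2)) * h p (z p).

(* The top value [K] marks a capped gain, which the cell does not bound. *)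
Definition saturated (_ : link) (v : 'I_K.+1) : R := (v == K :> nat)%:R.

Lemma posE (z : config) i : pos (z (i, i)) = (i \in strong z)%:R.
Proof. by rewrite inE. Qed.

Lemma sum_pos (z : config) : \sum_i pos (z (i, i)) = #|strong z|%:R.
Proof.
under eq_bigr do rewrite posE.
by rewrite -natr_sum -big_mkcond sum1_card.
Qed.

Lemma pair_sumE (h : link -> 'I_K.+1 -> R) (z : config) :
  pair_sum h z =
  \sum_(i in strong z) \sum_(j in strong z | j != i) h (j, i) (z (j, i)).
Proof.
transitivity (\sum_j \sum_i (if j != i then
    pos (z (j, j)) * pos (z (i, i)) * h (j, i) (z (j, i)) else 0)).
  by rewrite pair_bigA /= /pair_sum big_mkcond; apply: eq_bigr => -[j i].
rewrite exchange_big /= [RHS]big_mkcond; apply: eq_bigr => i _.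
rewrite posE; case: (i \in strong z); last first.
  by apply: big1 => j _; case: ifP; rewrite // mulr0 mul0r.
rewrite [RHS]big_mkcond; apply: eq_bigr => j _.
by rewrite posE mulr1; case: (j \in _); case: ifP; rewrite ?mul1r ?mul0r.
Qed.

Variables (pr : link -> 'I_K.+1 -> R) (q : R).
Hypothesis pr_ge0 : forall p v, 0 <= pr p v.
Hypothesis pr_sum1 : forall p, \sum_v pr p v = 1.
Hypothesis mean_pos : forall i, mean pr (i, i) pos = q.
Hypothesis mean_off : forall i j, i != j -> mean pr (i, j) (fun v => v%:R) <= 2.
Hypothesis K_gt0 : (0 < K)%N.
Let m := n%:R * q.

Definition centered (p : link) (v : 'I_K.+1) : R :=
  v%:R - mean pr p (fun v => v%:R).

Lemma pos_sqr (v : 'I_K.+1) : pos v ^+ 2 = pos v.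
Proof. by rewrite /pos -natrX; case: (0 < v)%N. Qed.

(** Off the diagonal, the link and the two direct links are three distinct coordinates: selecting
    the strong pairs does not bias the gains between them. *)
Lemma Ex_pair (p : link) (h : 'I_K.+1 -> R) : p.1 != p.2 ->
  Ex pr (fun z => pos (z (p.1, p.1)) * pos (z (p.2, p.2)) * h (z p))
  = q ^+ 2 * mean pr p h.
Proof.
case: p => i j /= ij.
rewrite (eq_Ex pr (psi := mono [:: ((i, i), pos); ((j, j), pos); ((i, j), h)])).
  have ji : (j == i) = false by rewrite eq_sym (negPf ij).
  have nij := negPf ij.
  rewrite (Ex_mono_cons pr_sum1); last by rewrite !inE !xpair_eqE nij !andbF.
  rewrite (Ex_mono_cons pr_sum1); last first.
    by rewrite !inE !xpair_eqE ji.
  by rewrite (Ex_mono_cons pr_sum1) // Ex_mono0 // !mean_pos mulr1 mulrA.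
by move=> z; rewrite /mono !big_cons big_nil mulr1 mulrA.
Qed.

Lemma Ex_strong_dev : Ex pr (fun z => (#|strong z|%:R - m) ^+ 2) <= m.
Proof.
rewrite (eq_Ex pr (psi := fun z => (\sum_i (pos (z (i, i)) - q)) ^+ 2)).
  rewrite /m -[in n%:R](card_ord n); apply: Ex_sqr_sum => // [i j _ _ ij|i _].
    rewrite (eq_Ex pr (psi := mono [:: ((i, i), fun v => pos v - q);
                                       ((j, j), fun v => pos v - q)])).
      rewrite (Ex_mono_cons pr_sum1) ?inE ?xpair_eqE ?andbb //.
      by rewrite -[in X in X * _](mean_pos i) mean_centered ?mul0r.
    by move=> z; rewrite /mono !big_cons big_nil mulr1.
  rewrite (eq_Ex pr (psi := mono [:: ((i, i), fun v => (pos v - q) ^+ 2)])).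
    rewrite (Ex_mono_cons pr_sum1) // Ex_mono0 // mulr1 -[in X in X <= _](mean_pos i).
    apply: le_trans (mean_variance pr_sum1 _ _) _.
    by rewrite -(mean_pos i) (eq_mean pr _ pos_sqr).
  by move=> z; rewrite /mono big_cons big_nil mulr1.
by move=> z; rewrite sumrB sum_pos sumr_const card_ord /m mulr_natl.
Qed.

Lemma card_off : #|[pred p : link | p.1 != p.2]|%:R <= n%:R ^+ 2 :> R.
Proof.
rewrite -natrX ler_nat; apply: leq_trans (max_card _) _.
by rewrite card_prod card_ord.
Qed.

(** Markov on each link: the indicator of [v = K] is at most [v / K]. There are at most n^2 links,
    each selected with probability [q ^+ 2]. *)
Lemma Ex_saturated : Ex pr (pair_sum saturated) <= 2 * m ^+ 2 / K%:R.
Proof.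
rewrite Ex_sum.
apply: (@le_trans _ _ (\sum_(p : link | p.1 != p.2) q ^+ 2 * (2 / K%:R))).
  apply: ler_sum => p pN; rewrite Ex_pair // ler_wpM2l ?sqr_ge0 //.
  rewrite mulrC; apply: le_trans (_ : K%:R^-1 * mean pr p (fun v => v%:R) <= _).
    rewrite -meanZ; apply: ler_mean => // v; rewrite /saturated.
    case: eqP => [->|_]; last by rewrite mulr_ge0 // invr_ge0.
    by rewrite mulVf // pnatr_eq0 -lt0n.
  by rewrite ler_wpM2l ?invr_ge0 //; case: p pN => i j; apply: mean_off.
rewrite sumr_const -[leLHS]mulr_natl.
have -> : 2 * m ^+ 2 / K%:R = n%:R ^+ 2 * (q ^+ 2 * (2 / K%:R)) by rewrite /m; ring.
by rewrite ler_wpM2r ?card_off // mulr_ge0 ?sqr_ge0 // divr_ge0.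
Qed.

(** Distinct links are uncorrelated even if they share endpoints, because the centred factor at [p]
    has a coordinate to itself. The cap gives [v ^+ 2 <= K * v], so the mean alone bounds the second
    moment by [2 * K]. *)
Lemma Ex_centered : Ex pr (fun z => pair_sum centered z ^+ 2) <= 2 * K%:R * m ^+ 2.
Proof.
have -> : 2 * K%:R * m ^+ 2 = n%:R ^+ 2 * (q ^+ 2 * (2 * K%:R)) by rewrite /m; ring.
apply: le_trans (_ : #|[pred p : link | p.1 != p.2]|%:R * (q ^+ 2 * (2 * K%:R)) <= _);
  last by rewrite ler_wpM2r ?card_off // mulr_ge0 ?sqr_ge0 // mulr_ge0.
apply: Ex_sqr_sum => [p p' pN p'N pp'|p pN].
  rewrite (eq_Ex pr (psi := mono [:: (p, centered p); ((p.1, p.1), pos);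
    ((p.2, p.2), pos); (p', centered p'); ((p'.1, p'.1), pos); ((p'.2, p'.2), pos)])).
    rewrite (Ex_mono_cons pr_sum1) ?mean_centered ?mul0r //.
    have off i : (p == (i, i)) = false.
      case: p pN {pp'} => a b /= ab; rewrite xpair_eqE; apply/negP => /andP[/eqP e /eqP e'].
      by rewrite e e' eqxx in ab.
    by rewrite /= !inE !off (negPf pp').
  by move=> z; rewrite /mono !big_cons big_nil /=; ring.
rewrite (eq_Ex pr (psi := fun z =>
    pos (z (p.1, p.1)) * pos (z (p.2, p.2)) * centered p (z p) ^+ 2)); last first.
  by move=> z; rewrite !exprMn !pos_sqr.
rewrite (Ex_pair (fun v => centered p v ^+ 2)) // ler_wpM2l ?sqr_ge0 //.
apply: le_trans (mean_variance pr_sum1 _ _) _.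
apply: le_trans (_ : mean pr p (fun v => K%:R * v%:R) <= _).
  apply: ler_mean => // v; rewrite expr2 ler_wpM2r // ler_nat -ltnS; exact: ltn_ord.
by rewrite meanZ mulrC ler_wpM2r //; case: p pN => i j; apply: mean_off.
Qed.

(* The configurations outside [good] have vanishing probability by Chebyshev
   and Markov; inside it the constants leave at most 3m/16 failures among the
   roughly m/2 active pairs when m = x/512. *)
Definition good (x : R) (z : config) : bool :=
  [&& m / 2 <= #|strong z|%:R, #|strong z|%:R <= 2 * m,
      pair_sum saturated z <= m / 16 & pair_sum centered z <= m * x / 64].

(** Each level is its deviation plus its mean, which is at most 2, and at most [#|strong z| ^+ 2]
    ordered pairs contribute. *)
Lemma pair_sum_le (z : config) : pair_sum (fun _ v => v%:R) z
  <= pair_sum centered z + 2 * #|strong z|%:R ^+ 2.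
Proof.
rewrite -lerBlDl /pair_sum -sumrB.
apply: le_trans (_ : \sum_(p : link | p.1 != p.2)
    2 * (pos (z (p.1, p.1)) * pos (z (p.2, p.2))) <= _).
  apply: ler_sum => -[i j] ij /=; rewrite /centered -mulrBr subKr mulrC ler_wpM2r ?mulr_ge0 //.
  exact: mean_off.
rewrite -mulr_sumr ler_wpM2l // -sum_pos expr2 mulr_suml.
under [leRHS]eq_bigr do rewrite mulr_sumr.
rewrite pair_bigA /= [leRHS](bigID (fun p : link => p.1 != p.2)) /= lerDl.
by apply: sumr_ge0 => p _; rewrite mulr_ge0.
Qed.

(** Union bound, one error term each: Chebyshev for the size of [strong z], Markov for the saturated
    links, Chebyshev for the centred interference. *)
Lemma Ex_bad (x : R) : 0 < x -> 0 < m ->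
  Ex pr (fun z => (~~ good x z)%:R) <= 4 / m + 32 * m / K%:R + 8192 * K%:R / x ^+ 2.
Proof.
move=> x0 m0.
have K0 : 0 < K%:R :> R by rewrite ltr0n.
pose A1 z := ~~ ((m / 2 <= #|strong z|%:R) && (#|strong z|%:R <= 2 * m)).
pose A2 z := ~~ (pair_sum saturated z <= m / 16).
pose A3 z := ~~ (pair_sum centered z <= m * x / 64).
apply: le_trans (_ : Ex pr (fun z => (A1 z)%:R + (A2 z)%:R + (A3 z)%:R) <= _).
  apply: ler_Ex => // z; rewrite /good andbA !negb_and -/(A2 z) -/(A3 z).
  rewrite -negb_and -/(A1 z) -!natrD ler_nat.
  by case: (A1 z); case: (A2 z); case: (A3 z).
rewrite !ExD lerD // ?lerD //.
- have -> : 4 / m = m / (m / 2) ^+ 2 by field; rewrite gt_eqF.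
  apply: le_trans (Ex_chebyshev (phi := fun z => #|strong z|%:R - m) (l := m / 2) _ _ _) _ => //.
  + by rewrite divr_gt0.
  + move=> z; rewrite /A1 negb_and -!ltNge => /orP[h|h]; rewrite ler_normr; apply/orP.
      right; lra.
    left; lra.
  + by rewrite ler_wpM2r ?Ex_strong_dev // invr_ge0 sqr_ge0.
- have -> : 32 * m / K%:R = (2 * m ^+ 2 / K%:R) / (m / 16) by field; rewrite !gt_eqF.
  apply: le_trans (Ex_markov (phi := pair_sum saturated) (l := m / 16) _ _ _ _) _ => //.
  + by rewrite divr_gt0.
  + by move=> z; apply: sumr_ge0 => p _; rewrite !mulr_ge0.
  + by move=> z; rewrite /A2 -ltNge => /ltW.
  + by rewrite ler_wpM2r ?Ex_saturated // invr_ge0 divr_ge0 // ltW.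
- have -> : 8192 * K%:R / x ^+ 2 = (2 * K%:R * m ^+ 2) / (m * x / 64) ^+ 2.
    by field; rewrite !gt_eqF.
  apply: le_trans (Ex_chebyshev (phi := pair_sum centered) (l := m * x / 64) _ _ _) _ => //.
  + by rewrite divr_gt0 // mulr_gt0.
  + by move=> z; rewrite /A3 -ltNge => /ltW h; rewrite ler_normr h.
  + by rewrite ler_wpM2r ?Ex_centered // invr_ge0 sqr_ge0.
Qed.

End Network.

Local Open Scope classical_set_scope.

(** * Throughput on a good configuration *)

Lemma top_k_sub (R : realType) (n k : nat) (gam : 'I_n -> 'I_n -> R)
    (S L : {set 'I_n}) (tau : R) :
  is_top_k gam k S -> (k <= #|L|)%N ->
  (forall i, (i \in L) = (tau < gam i i)) -> S \subset L.
Proof.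
move=> [Sk top] kL LE; apply/fintype.subsetP => i iS; apply/negPn/negP => iL.
(* [L] has at least [k] members and [S :\ i] only [k - 1], so some [j] in [L] is inactive; its
   direct gain exceeds [tau] while that of [i] does not, against [top]. *)
have /fintype.subsetPn[j jL jS] : ~~ (L \subset S :\ i).
  apply/negP => /subset_leq_card; rewrite leqNgt => /negP; apply.
  by rewrite (leq_trans _ kL) // -Sk [leqRHS](cardsD1 i) iS.
have {}jS : j \notin S.
  by apply: contra jS => jS; rewrite !inE jS andbT; apply: contraNneq iL => <-.
have := top _ _ iS jS; rewrite leNgt => /negP; apply.
by rewrite (le_lt_trans _ (_ : tau < _)) -?LE // leNgt -LE.
Qed.

Lemma throughputE (R : realType) (n : nat) (N0 beta : R) (gam : 'I_n -> 'I_n -> R)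
    (S : {set 'I_n}) :
  throughput N0 beta gam S = #|finset (successful N0 beta gam S)|.
Proof.
apply: eq_card => i; rewrite [RHS]inE.
by apply/idP/idP => [/set_mem|h] //; apply/mem_set.
Qed.

(** Purely deterministic: every failing active pair is charged at least 1 in total over its
    interferers in [L], and [good] bounds all charges together by 3m/16 with m = x/512. *)
Lemma throughput_good (R : realType) (n K k : nat) (pr : 'I_n * 'I_n -> 'I_K.+1 -> R)
    (q N0 beta mu tau x : R) (gam : 'I_n -> 'I_n -> R)
    (z : {ffun 'I_n * 'I_n -> 'I_K.+1}) (S : {set 'I_n}) :
  (forall i j, i != j -> mean pr (i, j) (fun v => v%:R) <= 2) ->
  0 < beta -> 0 < mu -> 0 < x -> n%:R * q = x / 512 -> 4096 <= x ->
  N0 <= mu * x / 4 -> beta * mu * x / 2 <= tau ->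
  (forall i, (0 < z (i, i))%N = (tau < gam i i)) ->
  (forall i j, i != j -> (z (i, j) < K)%N -> gam i j <= mu * (z (i, j))%:R) ->
  k%:R <= n%:R * q / 2 -> n%:R * q / 2 - 1 <= k%:R ->
  good pr q x z -> is_top_k gam k S ->
  x / 4096 <= (throughput N0 beta gam S)%:R.
Proof.
move=> mean_off b0 mu0 x0 mE x_big N0x tau_big zdiag zoff k_le k_ge.
rewrite /good mE => /and4P[L_ge L_le sat_le dev_le] topS.
rewrite mE in k_le k_ge.
set L := strong z in L_ge L_le.
have SL : S \subset L.
  apply: top_k_sub topS _ _ => [|i]; last by rewrite inE zdiag.
  by rewrite -(ler_nat R) (le_trans k_le).
pose ok := finset (successful N0 beta gam S).
have okS : ok \subset S by apply/fintype.subsetP => i; rewrite inE => /andP[].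
(* The charge of interferer [j] to [i]: 1 if the link is saturated, as its cell then bounds nothing,
   plus its level, scaled so that levels adding up to [x / 4] are worth 1. *)
pose w (i j : 'I_n) : R := saturated R (j, i) (z (j, i)) + 4 / x * (z (j, i))%:R.
have w_ge0 i j : 0 <= w i j by rewrite addr_ge0 // mulr_ge0 // divr_ge0 // ltW.
have fail_w i : i \in S :\: ok -> 1 <= \sum_(j in L | j != i) w i j.
  rewrite !inE /successful => /andP[+ iS]; rewrite iS /= -leNgt => fail_i.
  have tau_i : tau < gam i i by rewrite -zdiag; have := fintype.subsetP SL i iS; rewrite inE.
  (* Failure means [gam i i <= beta * (N0 + I)]; the left side exceeds [beta * mu * x / 2], and the
     noise accounts for at most half of this. *)
  have I_big : mu * (x / 4) < interference gam S i.
    rewrite -(ltr_pM2l b0); have := lt_le_trans (le_lt_trans tau_big tau_i) fail_i.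
    rewrite mulrDr; have := ler_wpM2l (ltW b0) N0x; lra.
  have [/existsP[j /and3P[jS ji /eqP jK]]|noK] :=
    boolP [exists j, [&& j \in S, j != i & z (j, i) == K :> nat]].
    rewrite (bigD1 j) /=; last by rewrite (fintype.subsetP SL).
    apply: le_trans (_ : w i j <= _); last by rewrite lerDl sumr_ge0.
    by rewrite /w /saturated jK eqxx lerDl mulr_ge0 // divr_ge0 // ltW.
  apply: le_trans (_ : 4 / x * \sum_(j in L | j != i) (z (j, i))%:R <= _); last first.
    by rewrite mulr_sumr ler_sum // => j _; rewrite lerDr.
  rewrite -ler_pdivrMl ?divr_gt0 // mulr1 invf_div -(ler_pM2l mu0).
  apply: le_trans (ltW I_big) _; rewrite /interference mulr_sumr.
  apply: le_trans (_ : \sum_(j in S | j != i) mu * (z (j, i))%:R <= _).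
    apply: ler_sum => j /andP[jS ji]; apply: zoff => //.
    rewrite ltn_neqAle -ltnS ltn_ord andbT; apply/negP => jK.
    by move/negP: noK; case; apply/existsP; exists j; rewrite jS ji.
  rewrite big_mkcondr [leRHS]big_mkcondr /= [leRHS](big_setID S) /= (finset.setIidPr SL).
  by rewrite lerDl sumr_ge0 // => j _; case: ifP => // _; rewrite mulr_ge0 // ltW.
have fail_le : #|S :\: ok|%:R <= 3 * (x / 512) / 16.
  apply: le_trans (_ : \sum_(i in L) \sum_(j in L | j != i) w i j <= _).
    rewrite -sum1_card natr_sum.
    apply: le_trans (_ : \sum_(i in S :\: ok) \sum_(j in L | j != i) w i j <= _).
      exact: ler_sum.
    rewrite [leRHS](big_setID (S :\: ok)) /= (finset.setIidPr _); last first.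
      exact: fintype.subset_trans (finset.subsetDl _ _) SL.
    by rewrite lerDl sumr_ge0 // => i _; apply: sumr_ge0.
  have -> : \sum_(i in L) \sum_(j in L | j != i) w i j =
      pair_sum (saturated R (n := n) (K := K)) z + 4 / x * pair_sum (fun _ v => v%:R) z.
    rewrite !pair_sumE mulr_sumr -big_split; apply: eq_bigr => i _ /=.
    by rewrite mulr_sumr -big_split.
  have h : pair_sum (fun _ v => v%:R) z <= x / 512 * x / 64 + 8 * (x / 512) ^+ 2.
    apply: le_trans (pair_sum_le mean_off z) _; apply: lerD => //.
    have : #|L|%:R ^+ 2 <= (2 * (x / 512)) ^+ 2.
      by rewrite lerXn2r ?nnegrE ?(le_trans _ L_le) ?ler0n.
    rewrite /L; lra.
  have x40 : 0 <= 4 / x by rewrite divr_ge0 // ltW.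
  have := ler_wpM2l x40 h.
  (* With m = x/512 both summands equal m/16, the second because 32 m^2 / x = m/16. *)
  have -> : 4 / x * (x / 512 * x / 64 + 8 * (x / 512) ^+ 2) = (x / 512) / 8.
    by field; rewrite gt_eqF.
  lra.
have : #|S|%:R = #|ok|%:R + #|S :\: ok|%:R :> R.
  by rewrite -natrD -(cardsID ok S) (finset.setIidPr okS).
(* At least x/1024 - 1 pairs are active and at most 3x/8192 fail; the remaining 5x/8192 - 1 is at
   least x/4096 as x >= 4096. *)
case: topS => -> _; rewrite throughputE -/ok; lra.
Qed.

(** * Reduction to finitely many values *)

(** [Q] is arbitrary: the event is a finite union, over the Boolean vectors satisfying [Q], of
    finite intersections of basic events or their complements. *)
Lemma measurable_finite_bool (d : measure_display) (T : measurableType d)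
    (J : finType) (b : J -> T -> bool) (Q : {ffun J -> bool} -> Prop) :
  (forall j, measurable [set w | b j w]) ->
  measurable [set w | Q [ffun j => b j w]].
Proof.
move=> mb.
rewrite (_ : [set w | _] = \bigcup_(v in [set v | Q v])
    \bigcap_(j in [set: J]) [set w | b j w = v j]).
  apply: fin_bigcup_measurable => // v _.
  apply: fin_bigcap_measurable => // j _.
  case: (v j); first exact: mb.
  rewrite (_ : [set w | _] = ~` [set w | b j w]); first exact: measurableC.
  by apply/seteqP; split => w /=; [move=> -> | move/negP/negbTE].
apply/seteqP; split => [w /= Qw|w [v /= Qv bv]].
  by exists [ffun j => b j w] => // j _ /=; rewrite ffunE.
rewrite (_ : [ffun j => b j w] = v) //.
by apply/ffunP => j; rewrite ffunE; apply: bv.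
Qed.

Section FiniteValued.
Context d (T : measurableType d) (R : realType) (P : probability T R).
Variables (V : finType) (Z : T -> V).
Hypothesis mZ : forall v, measurable (Z @^-1` [set v]).

(** The right side has the form of [mean], or of [Ex] when [Z] is a whole configuration: this is the
    passage from integrals to finite sums. *)
Lemma integral_finite_valued (h : V -> R) : (forall v, 0 <= h v) ->
  (\int[P]_w (h (Z w))%:E = (\sum_v fine (P (Z @^-1` [set v])) * h v)%:E)%E.
Proof.
move=> h0.
transitivity (\int[P]_w (\sum_(v <- index_enum V)
    (h v)%:E * (\1_(Z @^-1` [set v]) w)%:E))%E.
  apply: eq_integral => w _; rewrite (bigD1 (Z w)) //= big1.
    by rewrite indicE mem_set // mule1 adde0.
  by move=> v vZ; rewrite indicE memNset ?mule0 // => /= e; rewrite e eqxx in vZ.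
rewrite ge0_integral_sum //=; last 2 first.
- move=> v; apply: measurable_funeM; apply/measurable_EFinP; exact: measurable_indic.
- by move=> v w _; rewrite mule_ge0 // lee_fin.
rewrite -sumEFin; apply: eq_bigr => v _.
rewrite ge0_integralZl //=.
- rewrite integral_indic // setIT EFinM fineK ?fin_num_measure // muleC //.
- by apply/measurable_EFinP; exact: measurable_indic.
- by rewrite lee_fin.
Qed.

Lemma probability_finite_valued (A : pred V) :
  P [set w | A (Z w)] = (\sum_v fine (P (Z @^-1` [set v])) * (A v)%:R)%:E.
Proof.
have mA : measurable [set w | A (Z w)].
  rewrite (_ : [set w | _] = \bigcup_(v in [set v | A v]) Z @^-1` [set v]).
    exact: fin_bigcup_measurable.
  by apply/seteqP; split => [w Aw|w [v Av] /= ->] //; exists (Z w).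
rewrite -integral_finite_valued // -[X in P X = _]setIT -integral_indic //.
apply: eq_integral => w _; rewrite indicE; congr ((nat_of_bool _)%:R%:E).
by apply/idP/idP => [/set_mem|h] //; apply/mem_set.
Qed.

Lemma sum_finite_valued : \sum_v fine (P (Z @^-1` [set v])) = 1.
Proof.
apply: EFin_inj; rewrite -(probability_setT P).
rewrite (_ : setT = [set w | predT (Z w)]); last by apply/seteqP; split.
by rewrite probability_finite_valued; congr _%:E; apply: eq_bigr => v _; rewrite mulr1.
Qed.

End FiniteValued.

(* Equals min(K, ceil(s / delta)) for [s >= 0] and [delta > 0]. *)
Definition level (R : realType) (K : nat) (delta s : R) : nat :=
  (\sum_(l < K) (l%:R * delta < s)%R)%N.

Section Level.
Variables (R : realType) (delta : R).
Hypothesis delta_gt0 : 0 < delta.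

Lemma level_recr K (s : R) :
  level K.+1 delta s = (level K delta s + (K%:R * delta < s)%R)%N.
Proof. by rewrite /level big_ord_recr. Qed.

Lemma level_le K (s : R) : (level K delta s <= K)%N.
Proof.
elim: K => [|K IH]; first by rewrite /level big_ord0.
by rewrite level_recr -addn1 leq_add // leq_b1.
Qed.

Lemma le_level K (s : R) : (level K delta s < K)%N -> s <= delta * (level K delta s)%:R.
Proof.
elim: K => // K IH; rewrite level_recr.
case: (ltP (K%:R * delta) s) => [Ks|sK].
  rewrite addn1 ltnS => lt; have := IH lt; rewrite leNgt => /negP[].
  by apply: le_lt_trans Ks; rewrite mulrC ler_pM2r // ler_nat ltnW.
rewrite addn0 ltnS leq_eqVlt => /predU1P[->|/IH //].
by rewrite mulrC.
Qed.

(** Rounding up costs at most one unit [delta]. The nonnegative [t] is there because a negative [s]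
    has level 0. *)
Lemma level_ge K (s t : R) : 0 <= t -> s <= t -> delta * (level K delta s)%:R <= delta + t.
Proof.
move=> t0 st; elim: K => [|K IH].
  by rewrite /level big_ord0 mulr0 addr_ge0 // ltW.
rewrite level_recr; case: (ltP (K%:R * delta) s) => [Ks|_]; last by rewrite addn0.
apply: le_trans (_ : delta * K.+1%:R <= _).
  by rewrite ler_pM2l // ler_nat addn1 ltnS level_le.
by rewrite -natr1 mulrDr mulr1 addrC lerD2l mulrC (le_trans (ltW Ks)).
Qed.

End Level.

Lemma measurable_level (R : realType) (K : nat) (delta : R) (Q : nat -> Prop) :
  measurable [set s : R | Q (level K delta s)].
Proof.
pose b (l : 'I_K) (s : R) := l%:R * delta < s.
have := @measurable_finite_bool _ R _ b (fun v => Q (\sum_(l < K) v l)%N).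
under eq_set do under eq_bigr do rewrite ffunE.
apply => l; rewrite (_ : [set s | _] = `]l%:R * delta, +oo[%classic) //.
by apply/seteqP; split => s; rewrite /= /b in_itv /= andbT.
Qed.

(** * Means of the gains and of their levels *)

Lemma nonneg_part_integral (d : measure_display) (T : measurableType d) (R : realType)
    (P : probability T R) (X : T -> R) (mu : R) :
  measurable_fun [set: T] X -> P [set w | X w < 0] = 0%E ->
  (\int[P]_w (X w)%:E = mu%:E)%E ->
  (\int[P]_w (Num.max (X w) 0)%:E = mu%:E)%E.
Proof.
move=> mX X0 <-; apply: ae_eq_integral => //.
- by apply/measurable_EFinP; apply: measurable_maxr.
- by apply/measurable_EFinP.
(* The gains are nonnegative only almost surely; the two integrands can differ only on this null
   set. *)
exists [set w | X w < 0]; split => //.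
  rewrite (_ : [set w | _] = X @^-1` `]-oo, 0[%classic).
    by rewrite -[X in measurable X]setTI; apply: mX.
  by apply/seteqP; split => w; rewrite /= in_itv.
move=> w /= h; rewrite ltNge; apply/negP => Xw.
by apply: h => _; rewrite max_l.
Qed.

(** A level is at most 1 plus the positive part of [X] over [mu], whose mean is 1. *)
Lemma level_mean (d : measure_display) (T : measurableType d) (R : realType)
    (P : probability T R) (X : T -> R) (mu : R) (K : nat) :
  0 < mu -> measurable_fun [set: T] X -> P [set w | X w < 0] = 0%E ->
  (\int[P]_w (X w)%:E = mu%:E)%E ->
  (\int[P]_w (level K mu (X w))%:R%:E <= 2%:E)%E.
Proof.
move=> mu0 mX X0 /(nonneg_part_integral mX X0) Xmu.
have mlev : measurable_fun [set: T] (fun w => (level K mu (X w))%:R : R).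
  apply: (@measurableT_comp _ _ _ _ _ _ (fun s : R => (level K mu s)%:R : R)) => //.
  by move=> _ B mB; rewrite setTI; apply: (@measurable_level R K mu (fun k => B k%:R)).
have mmax : measurable_fun [set: T] (fun w => (Num.max (X w) 0)%:E).
  by apply/measurable_EFinP; apply: measurable_maxr.
apply: (@le_trans _ _ (\int[P]_w (1 + (mu^-1)%:E * (Num.max (X w) 0)%:E)))%E.
  apply: ge0_le_integral => //.
  - exact/measurable_EFinP.
  - by apply: emeasurable_funD => //; apply: measurable_funeM.
  move=> w _; rewrite -EFinM -EFinD lee_fin -(ler_pM2l mu0) mulrDr mulr1 mulVKf ?gt_eqF //.
  by apply: level_ge => //; rewrite le_max lexx ?orbT.
rewrite ge0_integralD //=; last 2 first.
- by move=> w _; rewrite -EFinM lee_fin mulr_ge0 ?invr_ge0 ?(ltW mu0) // le_max lexx orbT.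
- exact: measurable_funeM.
rewrite integral_cst // [Y in (_ * Y + _)%E](probability_setT P) mul1e.
rewrite ge0_integralZl //; last 2 first.
- by move=> w _; rewrite lee_fin le_max lexx orbT.
- by rewrite lee_fin invr_ge0 ltW.
by rewrite Xmu -EFinM mulVf ?gt_eqF // -EFinD.
Qed.

(** The positive part of [X] dominates the indicator of [X > 1]. Unbounded support thus yields
    [mu > 0]. *)
Lemma mean_gt0 (d : measure_display) (T : measurableType d) (R : realType)
    (P : probability T R) (X : T -> R) (mu : R) :
  measurable_fun [set: T] X -> P [set w | X w < 0] = 0%E ->
  (\int[P]_w (X w)%:E = mu%:E)%E -> (P [set w | (1 < X w)%R] != 0)%E -> 0 < mu.
Proof.
move=> mX X0 /(nonneg_part_integral mX X0) Xmu P1.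
have m1 : measurable [set w | 1 < X w].
  rewrite (_ : [set w | _] = X @^-1` `]1, +oo[%classic).
    by rewrite -[X in measurable X]setTI; apply: mX.
  by apply/seteqP; split => w; rewrite /= in_itv /= andbT.
rewrite -lte_fin -Xmu; apply: lt_le_trans (_ : P [set w | (1 < X w)%R] <= _)%E.
  by rewrite lt0e P1 measure_ge0.
rewrite -[X in P X]setIT -integral_indic //; apply: ge0_le_integral => //.
- by apply/measurable_EFinP; exact: measurable_indic.
- by apply/measurable_EFinP; apply: measurable_maxr.
move=> w _; rewrite lee_fin indicE; case: (boolP (w \in _)) => [/set_mem /ltW h|_] /=.
  by rewrite le_max h.
by rewrite le_max lexx orbT.
Qed.

(** * Quantiles *)

(** On [[a, b]], [F] is the constant mass left of [a] plus the integral of [f] from [a], continuous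
    in its upper limit. *)
Lemma density_continuous (R : realType) (F f : R -> R) (a b : R) :
  is_density F f -> a <= b -> {within `[a, b], continuous F}.
Proof.
move=> [mf [f0 FE]] ab.
have mEf (D : set R) : measurable_fun D (fun t => (f t)%:E).
  by apply: measurable_funS (_ : measurable_fun setT _) => //; apply/measurable_EFinP.
have leE (x : R) : [set t : R | t <= x] = `]-oo, x]%classic.
  by apply/seteqP; split => t; rewrite /= in_itv.
have Fsplit x : a <= x -> ((F x)%:E = \int[lebesgue_measure]_(t in `]-oo, a[) (f t)%:E
    + \int[lebesgue_measure]_(t in `[a, x]) (f t)%:E)%E.
  move=> ax; rewrite FE leE -ge0_integral_setU //.
  - congr (integral _ _ _); apply/seteqP; split => t; rewrite /= !in_itv /=.
      by move=> ->; case: (ltP t a) => _; [left|right].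
    by case=> [/ltW ta|/andP[_ ->]] //; apply: le_trans ax.
  - exact: mEf.
  - by move=> t _; rewrite lee_fin.
  - apply/disj_set2P; apply/seteqP; split => t //=; rewrite !in_itv /=.
    by case => ta /andP[at_ _]; rewrite ltNge at_ in ta.
have Cfin : (\int[lebesgue_measure]_(t in `]-oo, a[) (f t)%:E < +oo)%E.
  apply: le_lt_trans (ltry (F a)); rewrite (Fsplit _ (lexx a)) leeDl //.
  by apply: integral_ge0 => t _; rewrite lee_fin.
have fab : lebesgue_measure.-integrable `[a, b] (EFin \o f).
  apply/integrableP; split; first exact: mEf.
  apply: le_lt_trans (ltry (F b)); rewrite (Fsplit _ ab).
  under eq_integral do rewrite /= ger0_norm //.
  by rewrite leeDr // integral_ge0 // => t _; rewrite lee_fin.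
set C := fine (\int[lebesgue_measure]_(t in `]-oo, a[) (f t)%:E)%E.
apply: (@subspace_eq_continuous _ _ _
  (fun x => C + parameterized_integral lebesgue_measure a x f)).
  move=> x; rewrite inE /= in_itv /= => /andP[ax xb].
  apply: EFin_inj; rewrite Fsplit // EFinD /C fineK ?ge0_fin_numE //; last first.
    by apply: integral_ge0 => t _; rewrite lee_fin.
  congr (_ + _)%E; rewrite /parameterized_integral /Rintegral fineK //.
  apply: integrable_fin_num => //.
  by apply: integrableS fab => //; apply: subset_itvl; rewrite bnd_simp.
have int_cts := parameterized_integral_continuous ab fab.
by move=> x; apply: cvgD; [exact: cvg_cst | exact: int_cts].
Qed.

Section Cdf.
Context d (T : measurableType d) (R : realType) (P : probability T R).
Variables (X : T -> R) (F : R -> R).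
Hypothesis mX : measurable_fun [set: T] X.
Hypothesis XF : forall x, P [set w | X w <= x] = (F x)%:E.

Lemma measurable_le_cst x : measurable [set w | X w <= x].
Proof.
rewrite (_ : [set w | _] = X @^-1` `]-oo, x]%classic).
  by rewrite -[A in measurable A]setTI; apply: mX.
by apply/seteqP; split => w; rewrite /= in_itv.
Qed.

Lemma cdf_nondec x y : x <= y -> F x <= F y.
Proof.
move=> xy; rewrite -lee_fin -!XF; apply: le_measure; rewrite ?inE;
  [exact: measurable_le_cst..|].
by move=> w /= /le_trans; apply.
Qed.

Lemma cdf_nonneg x : 0 <= F x.
Proof. by rewrite -lee_fin -XF. Qed.

Lemma probability_gt x : P [set w | x < X w] = (1 - F x)%:E.
Proof.
rewrite (_ : [set w | _] = ~` [set w | X w <= x]).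
  by rewrite probability_setC ?XF //; exact: measurable_le_cst.
by apply/seteqP; split => w /=; rewrite ltNge => /negP.
Qed.

Lemma cdf_near1 (y : R) : 0 < y -> exists b, 1 - y < F b.
Proof.
move=> y0.
have : P \o (fun k : nat => [set w | X w <= k%:R]) @ \oo --> P (\bigcup_k [set w | X w <= k%:R]).
  apply: nondecreasing_cvg_mu.
  - by move=> k; exact: measurable_le_cst.
  - by apply: bigcupT_measurable => k; exact: measurable_le_cst.
  - by move=> j k jk; apply/subsetPset => w /= /le_trans; apply; rewrite ler_nat.
rewrite (_ : \bigcup_k _ = setT); last first.
  apply/seteqP; split => // w _; exists (Num.truncn (Num.max (X w) 0)).+1 => //=.
  apply: le_trans (_ : Num.max (X w) 0 <= _); first by rewrite le_max lexx.
  have max0 : 0 <= Num.max (X w) 0 by rewrite le_max lexx orbT.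
  by have /andP[_ /ltW] := truncn_itv max0.
rewrite probability_setT => /fine_cvg /cvgrPdist_lt /(_ _ y0) [k _ /(_ k)].
rewrite /= leqnn XF /= => /(_ isT) h; exists k%:R.
by have := ler_norm (1 - F k%:R); lra.
Qed.

Variable f : R -> R.
Hypothesis Ff : is_density F f.

(** Intermediate value theorem between [a] and a point whose tail is below [y]. *)
Lemma cdf_quantile (a y : R) : 0 < y -> y <= 1 - F a ->
  exists2 c, a <= c & F c = 1 - y.
Proof.
move=> y0 ya; have [b yb] := cdf_near1 y0.
have ab : a <= b.
  by rewrite leNgt; apply/negP => /ltW /cdf_nondec; lra.
have [|c] := IVT (v := 1 - y) ab (density_continuous Ff ab).
  by rewrite ge_min le_max; apply/andP; split; apply/orP; [left|right]; lra.
by rewrite in_itv /= => /andP[ac _] Fc; exists c.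
Qed.

Lemma cdf_neg0 : (forall x, x < 0 -> F x = 0) -> P [set w | X w < 0] = 0%E.
Proof.
move=> Fneg; have F0 : F 0 = 0.
  apply/eqP; rewrite -[_ == _]negbK; apply/negP => F0.
  have F0gt : 0 < F 0 by rewrite lt_def F0 cdf_nonneg.
  have N10 : (-1 : R) <= 0 by rewrite lerN10.
  (* Continuity excludes a jump at 0: the value [F 0 / 2] would be taken on [[-1, 0]], where [F]
     only takes the values 0 and [F 0]. *)
  have [|c] := IVT (v := F 0 / 2) N10 (density_continuous Ff N10).
    have := Fneg (-1) (ltrN10 R) => ->.
    by rewrite ge_min le_max; apply/andP; split; apply/orP; [left|right]; lra.
  rewrite in_itv /= => /andP[_]; rewrite le_eqVlt => /predU1P[->|/Fneg ->]; lra.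
apply/eqP; rewrite eq_le measure_ge0 andbT.
apply: le_trans (_ : P [set w | (X w <= 0)%R] <= _)%E; last by rewrite XF F0.
apply: le_measure; rewrite ?inE; [|exact: measurable_le_cst|by move=> w /= /ltW].
rewrite (_ : [set w | _] = X @^-1` `]-oo, 0[%classic).
  by rewrite -[A in measurable A]setTI; apply: mX.
by apply/seteqP; split => w; rewrite /= in_itv.
Qed.

End Cdf.

(** * Measurability of the throughput event *)

Lemma measurable_top_k_throughput (d : measure_display) (T : measurableType d)
    (R : realType) (n k : nat) (gam : 'I_n -> 'I_n -> T -> R) (N0 beta y : R) :
  (forall i j, measurable_fun [set: T] (gam i j)) ->
  measurable [set w | forall S : {set 'I_n},
    is_top_k (fun i j => gam i j w) k S ->
    y <= (throughput N0 beta (fun i j => gam i j w) S)%:R].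
Proof.
move=> mg.
(* The event depends on finitely many Booleans: the comparisons of direct gains, and the success of
   each destination under each active set. *)
pose b (p : 'I_n * 'I_n + {set 'I_n} * 'I_n) (w : T) : bool :=
  match p with
  | inl (i, j) => gam j j w <= gam i i w
  | inr (A, i) => successful N0 beta (fun i j => gam i j w) A i
  end.
pose Q (v : {ffun 'I_n * 'I_n + {set 'I_n} * 'I_n -> bool}) :=
  forall S : {set 'I_n},
    #|S| = k /\ (forall i j, i \in S -> j \notin S -> v (inl (i, j))) ->
    y <= #|finset (fun i => v (inr (S, i)))|%:R.
rewrite (_ : [set w | _] = [set w | Q [ffun p => b p w]]); last first.
  apply/seteqP; split => w /= H S [Sk St].
    rewrite (_ : finset _ = finset (successful N0 beta (fun i j => gam i j w) S)).
      rewrite -throughputE; apply: H; split => // i j iS jS.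
      by have := St i j iS jS; rewrite ffunE.
    by apply/setP => i; rewrite !inE ffunE.
  have := H S; rewrite throughputE.
  rewrite (_ : finset _ = finset (successful N0 beta (fun i j => gam i j w) S)).
    by apply; split => // i j iS jS; rewrite ffunE; exact: St.
  by apply/setP => i; rewrite !inE ffunE.
apply: measurable_finite_bool => -[[i j]|[S i]] /=.
  rewrite -[A in measurable A]setTI.
  exact: (measurable_fun_ler (mg j j) (mg i i) measurableT (Y := [set true])).
rewrite /successful; case: (i \in S) => /=; last first.
  rewrite (_ : [set w | _] = set0) //; by apply/seteqP; split.
rewrite -[A in measurable A]setTI.
have mI : measurable_fun [set: T] (fun w => beta * (N0 + interference (fun i j => gam i j w) S i)).
  apply: measurable_funM => //; apply: measurable_funD => //.
  rewrite /interference; under eq_fun do rewrite -big_filter.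
  exact: measurable_sum.
exact: (measurable_fun_ltr mI (mg i i) measurableT (Y := [set true])).
Qed.

(** * The network *)

Lemma Gfun_invE (R : realType) (F : R -> R) (beta mu x : R) (n : nat) :
  (forall y, F y < 1) -> Gfun F beta mu x = n%:R ->
  x = n%:R * (1 - F (beta * mu * x / 2)).
Proof.
move=> F1 <-; rewrite /Gfun mulfVK // subr_eq0 gt_eqF //; exact: F1.
Qed.

(** The bound of [Ex_bad] for m = x/512 and a cap [k] of order x^(3/2): the terms are at most
    2048/y, 1/y and 16384/y. *)
Lemma error_bound (R : realType) (x y k : R) : x = y ^+ 2 -> 1 <= y ->
  x * y < k -> k <= x * y + 1 ->
  4 / (x / 512) + 32 * (x / 512) / k + 8192 * k / x ^+ 2 <= 20000 / y.
Proof.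
move=> xE y1 k_gt k_le.
have y0 : 0 < y by lra.
have x0 : 0 < x by rewrite xE exprn_gt0.
have xy0 : 0 < x * y by rewrite mulr_gt0.
have k0 : 0 < k by lra.
have h1 : 4 / (x / 512) <= 2048 / y.
  rewrite ler_pdivrMr ?divr_gt0 ?ltr0n // [leRHS](_ : _ = 4 * y); first lra.
  by rewrite xE; field; rewrite gt_eqF.
have h2 : 32 * (x / 512) / k <= 1 / y.
  rewrite ler_pdivrMr // mulrAC ler_pdivlMr // mul1r; lra.
have h3 : 8192 * k / x ^+ 2 <= 16384 / y.
  have x2 : 1 <= x * y by rewrite xE -exprSr exprn_ege1.
  rewrite ler_pdivrMr ?exprn_gt0 // [leRHS](_ : _ = 16384 * (x * y)); first lra.
  by rewrite xE; field; rewrite gt_eqF.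
apply: le_trans (lerD (lerD h1 h2) h3) _.
rewrite -!mulrDl ler_wpM2r ?invr_ge0 ?ltW //; lra.
Qed.

Section NetworkBound.
Context d (T : measurableType d) (R : realType) (P : probability T R).
Variables (F f : R -> R) (mu N0 beta : R) (n : nat) (gam : 'I_n -> 'I_n -> T -> R).
Hypothesis beta_gt0 : 0 < beta.
Hypothesis mu_gt0 : 0 < mu.
Hypothesis Ff : is_density F f.
Hypothesis Fneg : forall x, x < 0 -> F x = 0.
Hypothesis F_lt1 : forall x, F x < 1.
Hypothesis mgam : forall i j, measurable_fun [set: T] (gam i j).
Hypothesis gamF : forall i j x, P [set w | gam i j w <= x] = (F x)%:E.
Hypothesis gam_indep : mutually_independent P (fun p : 'I_n * 'I_n => gam p.1 p.2).
Hypothesis gam_mean : forall i j, (\int[P]_w (gam i j w)%:E = mu%:E)%E.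

Section Cells.
Variables (K : nat) (tau : R).
Hypothesis K_gt0 : (0 < K)%N.

(* A diagonal cell only records whether the direct link is stronger than [tau];
   an off-diagonal one is the gain in units of [mu], rounded up and capped. *)
Definition cell (p : 'I_n * 'I_n) (s : R) : 'I_K.+1 :=
  inord (if p.1 == p.2 then nat_of_bool (tau < s) else level K mu s).

Definition cells (w : T) : {ffun 'I_n * 'I_n -> 'I_K.+1} :=
  [ffun p => cell p (gam p.1 p.2 w)].

Definition cell_law (p : 'I_n * 'I_n) (v : 'I_K.+1) : R :=
  fine (P ((fun w => cell p (gam p.1 p.2 w)) @^-1` [set v])).

Lemma cellE p s : cell p s =
  (if p.1 == p.2 then nat_of_bool (tau < s) else level K mu s) :> nat.
Proof.
(* [inord] defaults to 0 out of range; both values are in range, the diagonal one because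
   [0 < K]. *)
rewrite inordK //; case: ifP => _; last by rewrite ltnS level_le.
by rewrite ltnS (leq_trans (leq_b1 _)).
Qed.

Lemma measurable_cell p v : measurable (cell p @^-1` [set v]).
Proof.
rewrite /cell /preimage /=; case: (p.1 == p.2); last first.
  exact: (@measurable_level R K mu (fun k => inord k = v)).
pose Q (u : {ffun unit -> bool}) := inord (nat_of_bool (u tt)) = v.
rewrite (_ : [set s | _] = [set s : R | Q [ffun=> tau < s]]); last first.
  by apply/seteqP; split => s; rewrite /Q /= ffunE.
apply: measurable_finite_bool => _.
rewrite (_ : [set s | _] = `]tau, +oo[%classic) //.
by apply/seteqP; split => s; rewrite /= in_itv /= andbT.
Qed.

Lemma measurable_cell_gam p v :
  measurable ((fun w => cell p (gam p.1 p.2 w)) @^-1` [set v]).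
Proof.
rewrite -[A in measurable A]setTI.
exact: (mgam p.1 p.2 measurableT (measurable_cell p v)).
Qed.

Lemma cell_law_ge0 p v : 0 <= cell_law p v.
Proof. by apply: fine_ge0. Qed.

Lemma cell_law_sum1 p : \sum_v cell_law p v = 1.
Proof. by apply: sum_finite_valued => v; apply: measurable_cell_gam. Qed.

Lemma cell_law_diag i : mean cell_law (i, i) (@pos R K) = 1 - F tau.
Proof.
apply: EFin_inj; rewrite -(probability_gt (mgam i i) (gamF i i)).
rewrite -(probability_finite_valued P (measurable_cell_gam (i, i)) (fun v => (0 < v)%N)).
by congr (P _); apply/seteqP; split => w /=; rewrite cellE eqxx lt0b.
Qed.

Lemma cell_law_off i j : i != j -> mean cell_law (i, j) (fun v => v%:R) <= 2.
Proof.
move=> ij; rewrite -lee_fin.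
rewrite -(integral_finite_valued P (measurable_cell_gam (i, j)) (h := fun v => v%:R)) //.
under eq_integral do rewrite cellE (negPf ij).
apply: level_mean => //; exact: (cdf_neg0 (mgam i j) (gamF i j) Ff Fneg).
Qed.

Lemma cellsE z : cells @^-1` [set z] =
  \bigcap_(p in [set: 'I_n * 'I_n]) (gam p.1 p.2 @^-1` (cell p @^-1` [set z p])).
Proof.
apply/seteqP; split => [w /= <- p _ /=|w H /=]; first by rewrite ffunE.
by apply/ffunP => p; rewrite ffunE; exact: H.
Qed.

Lemma measurable_cells z : measurable (cells @^-1` [set z]).
Proof.
rewrite cellsE; apply: fin_bigcap_measurable => // p _; exact: measurable_cell_gam.
Qed.

(** Mutual independence of the gains enters here: the joint law of the cells is the product law of
    the finite model. *)
Lemma cells_law z : fine (P (cells @^-1` [set z])) = weight cell_law z.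
Proof.
rewrite cellsE gam_indep; last by move=> p; exact: measurable_cell.
rewrite (eq_bigr (fun p => (cell_law p (z p))%:E)) ?prodEFin // => p _.
by rewrite fineK // fin_num_measure //; exact: measurable_cell_gam.
Qed.

End Cells.

Lemma network_bound (x : R) :
  4096 <= x -> N0 <= mu * x / 4 -> Gfun F beta mu x = n%:R ->
  1 - 20000 / Num.sqrt x <= fine (P [set w | forall S : {set 'I_n},
      is_top_k (fun i j => gam i j w) (Num.truncn (x / 1024)) S ->
      4096^-1 * x <= (throughput N0 beta (fun i j => gam i j w) S)%:R]).
Proof.
move=> x_big N0x Gx; have xE := Gfun_invE F_lt1 Gx.
set tau0 := beta * mu * x / 2 in xE.
have x0 : 0 < x by lra.
have n0 : 0 < n%:R :> R.
  by rewrite ltr0n lt0n; apply/negP => /eqP n0; move: xE; rewrite n0 mul0r; lra.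
have i0 : 'I_n by case: (n) n0 => [|n' _]; [rewrite ltxx|exact: ord0].
pose q := x / 512 / n%:R.
have mE : n%:R * q = x / 512 by rewrite /q mulrC divfK // gt_eqF.
have c0 : (0 : R) < 512 by rewrite ltr0n.
have q0 : 0 < q := divr_gt0 (divr_gt0 x0 c0) n0.
(* As n (1 - F tau0) = x exceeds n q = x/512, the threshold can be raised from [tau0] to a point of
   tail exactly [q]. *)
have q_le : q <= 1 - F tau0.
  rewrite -(ler_pM2l n0) -xE mE; lra.
have [tau tau_ge Ftau] := cdf_quantile (mgam i0 i0) (gamF i0 i0) Ff q0 q_le.
pose y := Num.sqrt x.
have xy : x = y ^+ 2 by rewrite sqr_sqrtr // ltW.
have y1 : 1 <= y by rewrite -(sqrtr1 R) ler_wsqrtr //; lra.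
(* The cap has order x^(3/2): large against x, so that saturated links are
   rare, and small against x^2, so that the variance of the total interference
   is negligible. *)
pose K := (Num.truncn (x * y)).+1.
have xy0 : 0 <= x * y by rewrite mulr_ge0 ?sqrtr_ge0 ?(ltW x0).
have /andP[K_le K_ge] := truncn_itv xy0.
have K_gt0 : (0 < K)%N by [].
pose law := @cell_law K tau; pose Z := cells K tau.
have law_diag i : mean law (i, i) (@pos R K) = q.
  by rewrite cell_law_diag // Ftau; ring.
have law_off := cell_law_off tau K_gt0.
set E := [set w | _].
have mE_event : measurable E by exact: measurable_top_k_throughput.
have badE : P [set w | ~~ good law q x (Z w)] =
    (Ex law (fun z => (~~ good law q x z)%:R))%:E.
  rewrite (probability_finite_valued P (@measurable_cells K tau) (fun z => ~~ good law q x z)).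
  by congr _%:E; apply: eq_bigr => z _; rewrite cells_law.
(* A good configuration forces the event; the number of active pairs is the floor of x/1024 = m/2,
   where m = n q. *)
have sub : ~` E `<=` [set w | ~~ good law q x (Z w)].
  move=> w /= nE; apply/negP => gw; apply: nE => S topS; rewrite mulrC.
  have x1024 : 0 <= x / 1024 by rewrite divr_ge0 ?ler0n ?(ltW x0).
  have xhalf : x / 512 / 2 = x / 1024 by rewrite -mulrA -invfM -natrM.
  have /andP[k_le k_ge] := truncn_itv x1024.
  apply: (throughput_good law_off beta_gt0 mu_gt0 x0 mE x_big N0x tau_ge _ _ _ _ gw topS).
  - by move=> i; rewrite ffunE cellE // eqxx lt0b.
  - move=> i j ij; rewrite ffunE cellE // (negPf ij); exact: le_level.
  - by rewrite mE xhalf.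
  - by rewrite mE xhalf lerBlDr natr1 ltW.
have PE : fine (P (~` E)) <= Ex law (fun z => (~~ good law q x z)%:R).
  rewrite -lee_fin fineK ?fin_num_measure //; last exact: measurableC.
  rewrite -badE; apply: le_measure => //; rewrite inE; first exact: measurableC.
  rewrite (_ : [set w | _] = \bigcup_(z in [set z | ~~ good law q x z])
     (Z @^-1` [set z])).
    by apply: fin_bigcup_measurable => // z _; exact: measurable_cells.
  by apply/seteqP; split => [w h|w [z h /= ->]] //; exists (Z w).
have m0 : 0 < n%:R * q by rewrite mulr_gt0.
have := Ex_bad (@cell_law_ge0 K tau) (@cell_law_sum1 K tau) law_diag law_off K_gt0 x0 m0.
rewrite mE -/law => bad_le.
have K_le1 : K%:R <= x * y + 1 by rewrite /K -natr1 lerD2r.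
have := le_trans PE (le_trans bad_le (error_bound xy y1 K_ge K_le1)).
by rewrite probability_setC // fineB ?fin_num_measure //= lerBlDr -lerBlDl.
Qed.

End NetworkBound.

(** * Growth of the inverse of [G], and the limit *)

Lemma Gfun_inv_unbounded (R : realType) (F : R -> R) (beta mu : R) (xinv : nat -> R) :
  0 < beta -> 0 < mu -> (forall y, F y < 1) -> (forall y z, y <= z -> F y <= F z) ->
  (forall n : nat, Gfun F beta mu (xinv n) = n%:R) ->
  forall M : R, \forall n \near \oo, M <= xinv n.
Proof.
move=> b0 mu0 F1 Fle Gx M.
pose G0 := 1 - F (beta * mu * M / 2).
have G00 : 0 < G0 by rewrite subr_gt0.
(* If [xinv n < M], monotonicity of [F] gives xinv n = n (1 - F(beta mu xinv n / 2)) >= n G0, which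
   exceeds M once n > M / G0. *)
near=> n; rewrite leNgt; apply/negP => xM.
have n_big : M / G0 < n%:R.
  apply: lt_le_trans (_ : (Num.truncn `|M / G0|).+1%:R <= _).
    apply: le_lt_trans (ler_norm _) _.
    by have /andP[] := truncn_itv (normr_ge0 (M / G0)).
  by rewrite ler_nat; near: n; exact: nbhs_infty_ge.
move: n_big; rewrite ltr_pdivrMr // => /(lt_trans xM); rewrite ltNge => /negP; apply.
rewrite [leRHS](Gfun_invE F1 (Gx n)) ler_wpM2l // lerD2l lerN2 Fle //.
by rewrite ler_wpM2r ?invr_ge0 // ler_wpM2l ?ltW // mulr_gt0.
Unshelve. all: by end_near.
Qed.

Lemma divr_sqrt_lt (R : rcfType) (c e x : R) :
  0 <= c -> 0 < e -> (c / e) ^+ 2 < x -> c / Num.sqrt x < e.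
Proof.
move=> c0 e0 x_gt; have x0 : 0 < x by apply: le_lt_trans x_gt; exact: sqr_ge0.
rewrite ltr_pdivrMr ?sqrtr_gt0 // mulrC -ltr_pdivrMr //.
have ce0 : 0 <= c / e by rewrite divr_ge0 // ltW.
by rewrite -(ger0_norm ce0) -sqrtr_sqr ltr_sqrt.
Qed.

Unset Implicit Arguments.

Theorem theorem1 (R : realType) (F f : R -> R) (mu N0 beta : R)
  (d : nat -> measure_display) (T : forall n : nat, measurableType (d n))
  (P : forall n : nat, probability (T n) R)
  (gam : forall n : nat, 'I_n -> 'I_n -> T n -> R)
  (xinv : nat -> R) :
  0 <= N0 -> 0 < beta ->
  is_density F f ->
  (forall x, x < 0 -> F x = 0) ->
  (forall n (i j : 'I_n), measurable_fun [set: T n] (gam n i j)) ->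
  (forall n (i j : 'I_n) (x : R),
      P n [set w | gam n i j w <= x] = (F x)%:E) ->
  (forall n, mutually_independent (P n) (fun p : 'I_n * 'I_n => gam n p.1 p.2)) ->
  (forall n (i j : 'I_n), (\int[P n]_w (gam n i j w)%:E)%E = mu%:E) ->
  condition_set_1 F f ->
  (NHT_type f \/ HT_type F) ->
  (* xinv n = G^{-1}(n) *)
  (forall n : nat, Gfun F beta mu (xinv n) = n%:R) ->
  exists (c : R) (k : nat -> nat), 0 < c /\ (forall n, (k n <= n)%N) /\
    (fun n => fine (P n [set w | forall S : {set 'I_n},
        is_top_k (fun i j => gam n i j w) (k n) S ->
        c * xinv n <= (throughput N0 beta (fun i j => gam n i j w) S)%:R]))
    @ \oo --> (1 : R).
Proof.
move=> N00 b0 Ff Fneg mg gF indep gmean [F1 _] _ Gx.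
(* The single link of the one-pair network suffices to read off the properties of [F] and the sign
   of [mu]. *)
pose o := ord0 : 'I_1.
have Fle := cdf_nondec (mg 1%N o o) (gF 1%N o o).
have mu0 : 0 < mu.
  have X0 := cdf_neg0 (mg 1%N o o) (gF 1%N o o) Ff Fneg.
  apply: (mean_gt0 (mg 1%N o o) X0 (gmean 1%N o o)).
  by rewrite (probability_gt (mg 1%N o o) (gF 1%N o o)) eqe subr_eq0 gt_eqF.
(* The constant is that of [throughput_good]; [k n] is half of m = x/512, rounded down. *)
exists 4096^-1, (fun n => Num.truncn (xinv n / 1024)); split; first by rewrite invr_gt0 ltr0n.
have xE n := Gfun_invE F1 (Gx n).
have x_ge0 n : 0 <= xinv n by rewrite xE mulr_ge0 // subr_ge0 ltW.
split=> [n|].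
  have x1024 : 0 <= xinv n / 1024 by rewrite divr_ge0 ?ler0n.
  rewrite -(ler_nat R); have /andP[/le_trans + _] := truncn_itv x1024; apply.
  have : xinv n <= n%:R.
    by rewrite xE ler_piMr // lerBlDr lerDl (cdf_nonneg (gF 1%N o o)).
  by have := x_ge0 n; lra.
apply/cvgrPdist_lt => e e0.
have x_near := Gfun_inv_unbounded b0 mu0 F1 Fle Gx.
near=> n.
have x4096 : 4096 <= xinv n by near: n; exact: x_near.
have N0x : N0 <= mu * xinv n / 4.
  rewrite ler_pdivlMr ?ltr0n // mulrC -ler_pdivrMl // mulrC.
  by near: n; exact: x_near.
have x_gt : (20000 / e) ^+ 2 < xinv n.
  apply: (@lt_le_trans _ _ ((20000 / e) ^+ 2 + 1)); first by rewrite ltrDl ltr01.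
  by near: n; exact: x_near.
have := network_bound b0 mu0 Ff Fneg F1 (mg n) (gF n) (indep n) (gmean n) x4096 N0x (Gx n).
set p := fine _ => p_ge.
have p_le : p <= 1.
  rewrite -lee_fin fineK; first exact: probability_le1 (measurable_top_k_throughput _ _ _ _ (mg n)).
  by rewrite fin_num_measure //; exact: measurable_top_k_throughput.
rewrite ger0_norm ?subr_ge0 //.
rewrite ltrBlDr -ltrBlDl (lt_le_trans _ p_ge) // ltrD2l ltrN2.
exact: divr_sqrt_lt (ler0n _ _) e0 x_gt.
Unshelve. all: by end_near.
Qed.
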